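(* Let $n\ge 1$ and $R\ge 0$ be integers. Let $\phi(n,R)$ be the maximum total number of 0's in a minimal $(n,R)^+$-code, and let $\bar\phi(n,R)$ be the minimum total number of 1's in a minimal $(n,R)^+$-code. Assume that $R\le n$. Then: (1) $K^+(n,R)-K^+(n-1,R)\ge \phi(n,R)/n$; (2) $K^+(n-1,R)\le \bar\phi(n,R)/n$; (3) $K^+(n,R)<K^+(n+1,R)$; and (4) $K^+(n,R)>K^+(n,R+1)$.
   Context: $Q_n=\{0,1\}^n$ is ordered by $x\preceq y$ iff $x_i\le y_i$ for all $i$, and $d(x,y)$ is the Hamming distance. The downward directed ball is $B_n^-(x,R)=\{y\in Q_n: y\preceq x,\ d(x,y)\le R\}$. A set $\mathcal{C}\subseteq Q_n$ downward $R$-covers $Q_n$ if $Q_n=\bigcup_{c\in\mathcal{C}}B_n^-(c,R)$. $K^+(n,R)$ denotes the minimum size of a set $\mathcal{C}\subseteq Q_n$ that downward $R$-covers $Q_n$ (in particular $K^+(n,R)=1$ for $R\ge n$). A minimal $(n,R)^+$-code is a set $\mathcal{C}\subseteq Q_n$ of size $K^+(n,R)$ that downward $R$-covers $Q_n$. The total number of 0's (resp. 1's) in a code is the sum over its codewords of the number of coordinates equal to 0 (resp. 1).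
   Formalization: Part (4) is proved only for R < n, since at R = n it is false: K^+(n,n) = K^+(n,n+1) = 1; parts (1)-(3) are stated for all R ≤ n. *)

(* Defs.v *)
From HB Require Import structures.
From mathcomp Require Import all_boot all_order all_algebra.

Set Implicit Arguments.
Unset Strict Implicit.
Unset Printing Implicit Defensive.

Definition cube (n : nat) : finType := {ffun 'I_n -> bool}.

Section DirectedCovering.

Variables (n R : nat).
Implicit Types (x y c : cube n) (C : {set cube n}).

(* Bits are compared through the coercion of bool to nat. *)
Definition cube_le x y : bool := [forall i, (x i <= y i)%N].

Definition hamming x y : nat := #|[set i | x i != y i]|.

Definition down_ball x : {set cube n} :=
  [set y | cube_le y x && (hamming x y <= R)%N].

Definition down_covers C : bool :=
  [set: cube n] == \bigcup_(c in C) down_ball c.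

Lemma down_covers_setT : down_covers [set: cube n].
Proof.
rewrite /down_covers eq_sym; apply/eqP/setP => x; rewrite in_setT.
apply/bigcupP; exists x; rewrite ?in_setT // inE; apply/andP; split.
  by apply/forallP.
rewrite /hamming (_ : [set i | _] = set0) ?cards0 //.
by apply/setP => i; rewrite !inE eqxx.
Qed.

(* The whole cube is only the starting candidate of the minimization; it is
   admissible by [down_covers_setT]. *)
Definition opt_code : {set cube n} :=
  [arg min_(C < [set: cube n] | down_covers C) #|C|].

Definition Kplus : nat := #|opt_code|.

Definition minimal_code C : bool := down_covers C && (#|C| == Kplus).

Definition total_zeros C : nat := \sum_(c in C) #|[set i | c i == false]|.

Definition total_ones C : nat := \sum_(c in C) #|[set i | c i == true]|.

Definition phi : nat := \max_(C | minimal_code C) total_zeros C.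

(* [opt_code] is admissible here by [minimal_opt_code]. *)
Definition phibar : nat :=
  total_ones [arg min_(C < opt_code | minimal_code C) total_ones C].

Lemma down_covers_opt_code : down_covers opt_code.
Proof. by rewrite /opt_code; case: arg_minnP => //; exact: down_covers_setT. Qed.

Lemma Kplus_min C : down_covers C -> (Kplus <= #|C|)%N.
Proof.
rewrite /Kplus /opt_code; case: arg_minnP => [|D _ minD]; last exact: minD.
exact: down_covers_setT.
Qed.

Lemma minimal_opt_code : minimal_code opt_code.
Proof. by rewrite /minimal_code down_covers_opt_code eqxx. Qed.

Lemma phi_max C : minimal_code C -> (total_zeros C <= phi)%N.
Proof. by move=> minC; rewrite /phi (leq_bigmax_cond (F := total_zeros)). Qed.

Lemma phi_attained : exists2 C, minimal_code C & total_zeros C = phi.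
Proof.
have [|C minC eqC] := @eq_bigmax_cond _ minimal_code total_zeros.
  by apply/card_gt0P; exists opt_code; exact: minimal_opt_code.
by exists C.
Qed.

Lemma phibar_min C : minimal_code C -> (phibar <= total_ones C)%N.
Proof.
rewrite /phibar; case: arg_minnP => [|D _ minD]; last exact: minD.
exact: minimal_opt_code.
Qed.

Lemma phibar_attained : exists2 C, minimal_code C & total_ones C = phibar.
Proof.
rewrite /phibar; case: arg_minnP => [|C minC _]; first exact: minimal_opt_code.
by exists C.
Qed.

End DirectedCovering.

(* Main.v *)
(* Fix a coordinate i of a code C that downward R-covers Q_(n+1). A word with a
   1 in coordinate i is covered only by codewords with a 1 there, so the
   codewords with c_i = 1, punctured at i, R-cover Q_n and there are at least
   K(n, R) of them. Summing over i bounds the ones of C from below, hence its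
   zeros from above: this is (1) and (2). When R <= n the all-ones word alone
   does not cover 0, so some codeword has a zero, which makes the bound strict
   at some i and gives (3). Finally, appending a 1 to all words of a code that
   R-covers Q_n gives a code that (R+1)-covers Q_(n+1), so
   K(n+1, R+1) <= K(n, R) < K(n+1, R), which is (4). *)
Require Import Defs.
From HB Require Import structures.
From mathcomp Require Import all_boot all_order all_algebra.
Import Order.TTheory GRing.Theory Num.Theory.
Local Open Scope ring_scope.

Section Puncturing.
Local Open Scope nat_scope.

Definition puncture {n} (i : 'I_n.+1) (x : cube n.+1) : cube n :=
  [ffun j => x (lift i j)].

Definition insert {n} (i : 'I_n.+1) (b : bool) (y : cube n) : cube n.+1 :=
  [ffun j => if unlift i j is Some k then y k else b].

Lemma insert_at n (i : 'I_n.+1) b (y : cube n) : insert i b y i = b.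
Proof. by rewrite ffunE unlift_none. Qed.

Lemma insertK n (i : 'I_n.+1) b : cancel (insert i b) (puncture i).
Proof. by move=> y; apply/ffunP => j; rewrite !ffunE liftK. Qed.

Lemma hamming_puncture n (i : 'I_n.+1) (x y : cube n.+1) :
  hamming x y = (x i != y i) + hamming (puncture i x) (puncture i y).
Proof.
rewrite /hamming -!sum1dep_card big_mkcond (bigD1_ord i) //=.
rewrite [in RHS]big_mkcond; congr (_ + _).
by apply: eq_bigr => j _; rewrite !ffunE.
Qed.

Lemma cube_le_puncture n (i : 'I_n.+1) (x y : cube n.+1) :
  cube_le x y = (x i <= y i) && cube_le (puncture i x) (puncture i y).
Proof.
apply/forallP/andP => [le_xy | [le_i /forallP le_xy] j].
  by split=> //; apply/forallP => j; rewrite !ffunE.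
by case: (unliftP i j) => [k ->|-> //]; have := le_xy k; rewrite !ffunE.
Qed.

Lemma down_coversP n R (C : {set cube n}) :
  reflect (forall y, exists2 c, c \in C & cube_le y c && (hamming c y <= R))
          (down_covers R C).
Proof.
apply: (iffP eqP) => [coverC y | coverC].
  have: y \in [set: cube n] by rewrite inE.
  by rewrite coverC => /bigcupP[c Cc]; rewrite inE; exists c.
apply/esym/setP => y; rewrite inE; apply/bigcupP.
by have [c Cc yc] := coverC y; exists c; rewrite ?inE.
Qed.

Lemma Kplus_le_ones_at n R (C : {set cube n.+1}) (i : 'I_n.+1) :
  down_covers R C -> Kplus n R <= #|[set c in C | c i]|.
Proof.
move=> /down_coversP coverC.
apply: leq_trans (leq_imset_card (puncture i) _); apply: Kplus_min.
(* Any [c] above the lift of [y] by a 1 has a 1 at [i] too, so puncturing leaves their distance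
   unchanged. *)
apply/down_coversP => y; have [c Cc] := coverC (insert i true y).
rewrite (cube_le_puncture n i) (hamming_puncture n i) insert_at insertK.
case ci: (c i) => //= yc; exists (puncture i c) => //.
by apply: imset_f; rewrite inE Cc ci.
Qed.

(** Double counting: the matrix of codewords is summed by columns instead of rows. *)
Lemma total_ones_by_coord n (C : {set cube n}) :
  total_ones C = \sum_(i < n) #|[set c in C | c i]|.
Proof.
rewrite /total_ones.
under eq_bigr => c _ do rewrite -sum1dep_card big_mkcond.
rewrite exchange_big; apply: eq_bigr => i _.
rewrite -sum1dep_card -big_mkcondr; apply: eq_bigl => c.
by rewrite eqb_id.
Qed.

Lemma total_zeros_ones n (C : {set cube n}) :
  total_zeros C + total_ones C = n * #|C|.
Proof.
rewrite /total_zeros /total_ones -big_split mulnC -sum_nat_const.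
apply: eq_bigr => c _.
have ->: [set i | c i == false] = ~: [set i | c i == true].
  by apply/setP => i; rewrite !inE; case: (c i).
by rewrite /= addnC cardsC card_ord.
Qed.

Lemma Kplus_le_total_ones n R (C : {set cube n.+1}) :
  down_covers R C -> n.+1 * Kplus n R <= total_ones C.
Proof.
move=> coverC; rewrite total_ones_by_coord -[X in X * _]card_ord -sum_nat_const.
by apply: leq_sum => i _; apply: Kplus_le_ones_at.
Qed.

Lemma down_covers_zero n R (C : {set cube n}) :
  R < n -> down_covers R C -> exists c i, c \in C /\ ~~ c i.
Proof.
move=> ltRn /down_coversP /(_ [ffun=> false]) [c Cc /andP[_ leR]].
have [i ci0|c1] := pickP (fun i => ~~ c i); first by exists c, i.
(* Otherwise [c] is the all-ones word, too far from the zero word that it covers. *)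
suff ham_n: hamming c [ffun=> false] = n by rewrite ham_n leqNgt ltRn in leR.
rewrite /hamming -[RHS]card_ord -cardsT; congr #|pred_of_set _|.
by apply/setP => i; rewrite !inE ffunE; move/negbFE: (c1 i) => ->.
Qed.

Lemma Kplus_ltS n R : R <= n -> Kplus n R < Kplus n.+1 R.
Proof.
move=> leRn; have coverC := down_covers_opt_code n.+1 R.
have [//|c [i [Cc ci0]]] := down_covers_zero n.+1 R _ _ coverC.
apply: leq_ltn_trans (Kplus_le_ones_at _ _ _ i coverC) (proper_card _).
apply/properP; split; first by apply/subsetP => x; rewrite inE => /andP[].
by exists c; rewrite // inE (negPf ci0) andbF.
Qed.

Lemma Kplus_SS n R : Kplus n.+1 R.+1 <= Kplus n R.
Proof.
have /down_coversP coverC := down_covers_opt_code n R.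
apply: leq_trans (leq_imset_card (insert ord0 true) _); apply: Kplus_min.
apply/down_coversP => y; have [c Cc /andP[le_yc d_yc]] := coverC (puncture ord0 y).
exists (insert ord0 true c); first exact: imset_f.
rewrite (cube_le_puncture n ord0) (hamming_puncture n ord0) insert_at insertK.
(* The inserted 1 dominates either bit of [y] and adds at most 1 to the distance, which the radius
   [R.+1] absorbs. *)
by rewrite le_yc leq_b1; exact: leq_add (leq_b1 _) d_yc.
Qed.

End Puncturing.

(** Part (4) is guarded by [R < n]: at [R = n] the all-ones word alone covers, so both sides equal
    1. *)
Theorem proposition16 (n R : nat) (hn : (1 <= n)%N) (hR : (R <= n)%N) :
  [/\ (phi n R)%:R / n%:R <= (Kplus n R)%:R - (Kplus (n - 1) R)%:R :> rat,
      (Kplus (n - 1) R)%:R <= (phibar n R)%:R / n%:R :> rat,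
      (Kplus n R < Kplus n.+1 R)%N
    & (R < n)%N -> (Kplus n R.+1 < Kplus n R)%N].
Proof.
case: n hn hR => // n _ leRn; rewrite subn1 /=.
have n_gt0 : 0 < n.+1%:R :> rat by rewrite ltr0n.
split.
- rewrite ler_pdivrMr //.
  have [C /andP[coverC /eqP cardC] <-] := phi_attained n.+1 R.
  rewrite mulrBl lerBrDr -!natrM -natrD ler_nat -cardC.
  (* Splitting [n.+1 * #|C|] into zeros and ones cancels the zeros and leaves the lower bound on the
     ones. *)
  rewrite [leqRHS]mulnC -total_zeros_ones leq_add2l mulnC.
  exact: Kplus_le_total_ones.
- rewrite ler_pdivlMr // -natrM ler_nat mulnC.
  have [C /andP[coverC _] <-] := phibar_attained n.+1 R.
  exact: Kplus_le_total_ones.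
- exact: Kplus_ltS.
- by move=> ltRn; apply: leq_ltn_trans (Kplus_SS n R) (Kplus_ltS n R ltRn).
Qed.
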